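(* $\mathrm{CR}(6,3)=26$. That is, every edge-coloring of $K_{26}$ (with an arbitrary number of colors) contains an orderable copy of $K_6$ or a rainbow copy of $K_3$, and there is an edge-coloring of $K_{25}$ containing neither an orderable copy of $K_6$ nor a rainbow copy of $K_3$.
   Context: An edge-coloring $\chi$ of a graph $G$ (any number of colors, not necessarily proper) is called orderable if there is a linear ordering of the vertices of $G$ such that the color of an edge is determined by its lower endpoint: whenever $i$ is adjacent to $j$ and $k$ and $i$ precedes both $j$ and $k$ in the ordering, $\chi(ij)=\chi(ik)$. (Different lower endpoints are allowed to give the same color, so monochromatic colorings are orderable.) A coloring is rainbow if all edges have pairwise different colors. A copy of $G$ in an edge-colored $K_n$ is a (not necessarily induced) subgraph of $K_n$ isomorphic to $G$, with the inherited coloring. The unordered canonical Ramsey number $\mathrm{CR}(s,t)$ is the smallest integer $n$ such that every edge-coloring of $K_n$, with an arbitrary number of colors, contains an orderable copy of $K_s$ or a rainbow copy of $K_t$. *)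

(* Defs.v *)
From HB Require Import structures.
From mathcomp Require Import all_boot.

Set Implicit Arguments.
Unset Strict Implicit.
Unset Printing Implicit Defensive.

Record sgraph := SGraph {
  vertex :> finType;
  adj : rel vertex;
  adj_sym : symmetric adj;
  adj_irr : irreflexive adj
}.

Arguments adj {s} x y.

Definition edges (G : sgraph) : {set {set G}} :=
  [set e : {set G} | [exists x, exists y, adj x y && (e == [set x; y])]].

Section Complete.
Variable n : nat.

Definition K_adj : rel 'I_n := fun x y => x != y.

Lemma K_adj_sym : symmetric K_adj.
Proof. by move=> x y; rewrite /K_adj eq_sym. Qed.

Lemma K_adj_irr : irreflexive K_adj.
Proof. by move=> x; rewrite /K_adj eqxx. Qed.

Definition K : sgraph := SGraph K_adj_sym K_adj_irr.
End Complete.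

(* An edge-coloring of G with colors in C is represented by a function          *)
(* {set G} -> C, of which only the values on edges G are ever used.             *)

Definition linear_order (T : Type) (r : rel T) : Prop :=
  [/\ reflexive r, antisymmetric r, transitive r & total r].

(* Adjacent vertices are distinct, so the non-strict comparisons r i j and      *)
(* r i k below are in fact strict.                                              *)
Definition orderable (G : sgraph) (C : Type) (chi : {set G} -> C) : Prop :=
  exists r : rel G, linear_order r /\
    forall i j k : G, adj i j -> adj i k -> r i j -> r i k ->
      chi [set i; j] = chi [set i; k].

Definition rainbow (G : sgraph) (C : Type) (chi : {set G} -> C) : Prop :=
  {in edges G &, injective chi}.

(* A copy of G in H is the image of an injective homomorphism f : G -> H; the   *)
(* inherited coloring is transported back to G along f.                         *)
Definition embedding (G H : sgraph) (f : G -> H) : Prop :=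
  injective f /\ forall x y : G, adj x y -> adj (f x) (f y).

Definition inherited (G H : sgraph) (C : Type) (chi : {set H} -> C)
    (f : G -> H) : {set G} -> C :=
  fun e => chi (f @: e).

Definition has_orderable_copy (G H : sgraph) (C : Type)
    (chi : {set H} -> C) : Prop :=
  exists f : G -> H, embedding f /\ orderable (inherited chi f).

Definition has_rainbow_copy (G H : sgraph) (C : Type)
    (chi : {set H} -> C) : Prop :=
  exists f : G -> H, embedding f /\ rainbow (inherited chi f).

Definition canonical_ramsey (s t n : nat) : Prop :=
  forall (C : Type) (chi : {set K n} -> C),
    has_orderable_copy (K s) chi \/ has_rainbow_copy (K t) chi.

(* CR(s, t) = n *)
Definition is_CR (s t n : nat) : Prop :=
  canonical_ramsey s t n /\ forall m, canonical_ramsey s t m -> n <= m.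

(* Main.v *)
(** Call a coloring without rainbow triangle a Gallai coloring, and let [F k] be
the largest order of one whose orderable sets have at most [k] vertices.  By
induction (contract a module, or delete a vertex if there is none) a Gallai
coloring has a proper module [X] joined to the outside in at most two colors.

If one color occurs, a vertex across the cut can be put in front of an orderable
set on either side, so the order is at most [2 F(k-1)].  If two colors [a], [b]
occur, one can put two vertices in front of [X], and a vertex of [X] in front of
each color neighbourhood, so the order is at most [F(k-2) + 2 F(k-1)].  This gives
[F 3 <= 5] and, from [F 4 <= 10], [F 5 <= 5 + 10 + 10].  For [F 4] it only gives
[12]; orders 11 and 12 would force a two-colored 5-regular coloring on 11
vertices, against parity.  Substituting pentagons into a pentagon, with new
colors, attains [25]. *)

Require Import Defs.
From HB Require Import structures.
From mathcomp Require Import all_boot.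
From mathcomp Require Import boolp.
From mathcomp Require Import zify.

Set Implicit Arguments.
Unset Strict Implicit.
Unset Printing Implicit Defensive.

(** * Parity of degree sums *)

Lemma sum_degree_even (T : finType) (V : {set T}) (e : rel T) :
  symmetric e -> irreflexive e ->
  ~~ odd (\sum_(x in V) #|[set y in V | e x y]|).
Proof.
move=> eC eirr.
(* Summed over [V], [lo] counts each edge at its lower end and [hi] at its upper end, so the two
   sums agree. *)
pose lo x := #|[set y in V | e x y && (enum_rank x < enum_rank y)]|.
pose hi x := #|[set y in V | e x y && (enum_rank y < enum_rank x)]|.
have lohi x : #|[set y in V | e x y]| = lo x + hi x.
  rewrite /lo /hi -cardsUI -[LHS]addn0; congr (#|pred_of_set _| + _).
    apply/setP => y; rewrite !inE -andb_orr -andb_orr -neq_ltn.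
    case: (y \in V) => //=; case exy: (e x y) => //=; symmetry.
    by apply/eqP => /val_inj /enum_rank_inj xy; rewrite xy eirr in exy.
  apply/esym/eqP; rewrite cards_eq0; apply/eqP/setP => y; rewrite !inE.
  by apply/negP => /andP [/and3P [_ _ ?] /and3P [_ _ ?]]; lia.
rewrite (eq_bigr _ (fun x _ => lohi x)) big_split /=.
suff -> : \sum_(x in V) hi x = \sum_(x in V) lo x by rewrite addnn odd_double.
have cardE (B : rel T) x : #|[set y in V | B x y]| = \sum_(y in V | B x y) 1.
  by rewrite -sum1_card; apply: eq_bigl => y; rewrite inE.
rewrite /hi /lo.
under eq_bigr do rewrite (cardE (fun x y => e x y && (enum_rank y < enum_rank x))).
under [RHS]eq_bigr do rewrite (cardE (fun x y => e x y && (enum_rank x < enum_rank y))).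
rewrite (exchange_big_dep (mem V)) /=; last by move=> x y _ /andP [].
apply: eq_bigr => x xV; apply: eq_bigl => y.
by rewrite xV eC /=.
Qed.

(** * Modules in Gallai colorings *)

Section Gallai.
Variables (T : finType) (D : eqType) (c : T -> T -> D).
Hypothesis csym : forall x y, c x y = c y x.
Hypothesis gallai : forall x y z, x != y -> y != z -> x != z ->
  [\/ c x y = c x z, c x y = c y z | c x z = c y z].

Implicit Types (V W X Z P : {set T}) (d a b : D).

Definition homogeneous (V X : {set T}) := forall p x y,
  p \in V -> p \notin X -> x \in X -> y \in X -> c p x = c p y.

Definition color_rel (V : {set T}) (d : D) : rel T :=
  fun u w => [&& u \in V, w \in V, u != w & c u w == d].

Definition color_comp V d x := [set y | connect (color_rel V d) x y].

Lemma color_comp_ind V d x (P : T -> Prop) : P x ->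
  (forall u w, P u -> color_rel V d u w -> P w) ->
  forall y, y \in color_comp V d x -> P y.
Proof.
move=> Px eP y; rewrite inE => /connectP [p ep ->].
elim: p x Px ep => //= u p IH x Px /andP [exu ep].
by apply: IH ep; apply: eP exu.
Qed.

Lemma color_rel_sym V d : symmetric (color_rel V d).
Proof.
by move=> x y; rewrite /color_rel eq_sym csym; case: (x \in V); case: (y \in V).
Qed.

Lemma color_comp_sym V d x y :
  (y \in color_comp V d x) = (x \in color_comp V d y).
Proof. by rewrite !inE; apply: (sym_connect_sym (@color_rel_sym V d)). Qed.

Lemma color_comp_sub V d x : x \in V -> color_comp V d x \subset V.
Proof.
by move=> xV; apply/subsetP; apply: color_comp_ind => // u w _ /and4P [].
Qed.

Lemma color_comp_trans V d x y z :
  y \in color_comp V d x -> z \in color_comp V d y -> z \in color_comp V d x.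
Proof. by rewrite !inE; apply: connect_trans. Qed.

Lemma color_comp_edge V d x y : x \in V -> y \in V -> x != y -> c x y = d ->
  y \in color_comp V d x.
Proof.
by move=> xV yV xy cxy; rewrite inE connect1 // /color_rel xV yV xy cxy eqxx.
Qed.

(** A vertex [p] outside the component sends no edge of color [d] into it, so for an edge [u w] of
    color [d] the triangle [p u w] avoids being rainbow only by [c p u = c p w]. *)
Lemma color_comp_homogeneous V d x : x \in V -> homogeneous V (color_comp V d x).
Proof.
move=> xV p y z pV pZ yZ zZ.
suff H u : u \in color_comp V d x -> c p u = c p x by rewrite !H.
move=> xu; suff [] : u \in color_comp V d x /\ c p u = c p x by [].
move: u xu; apply: color_comp_ind; first by rewrite inE connect0.
move=> u w [uZ <-] uw; have wZ : w \in color_comp V d x.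
  by apply: color_comp_trans uZ _; rewrite inE connect1.
split=> //; case/and4P: uw => uV wV uw /eqP cuw.
have pu : p != u by apply: contraNneq pZ => ->.
have pw : p != w by apply: contraNneq pZ => ->.
have no t : t \in V -> p != t -> t \in color_comp V d x -> c p t <> d.
  move=> tV pt tZ cpt; case/negP: pZ; apply: color_comp_trans tZ _.
  by apply: color_comp_edge; rewrite // 1?eq_sym // csym.
have := gallai pu uw pw; rewrite cuw => -[|/no|/no] //.
  by move=> H; case: H.
by move=> H; case: H.
Qed.

(** The case [a = b] covers modules joined to the outside in one color. *)
Definition two_colored_module V X a b :=
  [/\ X \subset V, exists x, x \in X, exists2 p, p \in V & p \notin X,
      homogeneous V X
    & forall p x, p \in V -> p \notin X -> x \in X -> c p x = a \/ c p x = b].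

Lemma two_colored_module1 V v a b : v \in V -> 1 < #|V| ->
  (forall u, u \in V -> u != v -> c v u = a \/ c v u = b) ->
  two_colored_module V [set v] a b.
Proof.
move=> vV V1 H; split.
- by rewrite sub1set.
- by exists v; rewrite inE.
- have : 0 < #|V :\ v| by move: V1; rewrite (cardsD1 v) vV.
  by case/card_gt0P => p; rewrite !inE => /andP [pv pV]; exists p; rewrite ?inE.
- by move=> p x y _ _ /set1P -> /set1P ->.
by move=> p x pV; rewrite inE => pv /set1P ->; rewrite csym; apply: H.
Qed.

(** The vertex [z] stands for all of [Z]: if [z] lies in [X], then [X :|: Z] is the module;
    otherwise [X] itself is, since every vertex of [Z] sees [X] as [z] does. *)
Lemma contract_module (V Z : {set T}) z X a b :
  Z \subset V -> homogeneous V Z -> z \in Z ->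
  two_colored_module (V :\: (Z :\ z)) X a b ->
  exists X', two_colored_module V X' a b.
Proof.
move=> ZV hZ zZ [XV [x0 x0X] [p0 p0V p0X] hX colX].
have zV : z \in V by apply: (subsetP ZV).
have inV2 p : (p \in V :\: (Z :\ z)) = (p \in V) && ((p \notin Z) || (p == z)).
  by rewrite !inE negb_and negbK andbC orbC.
have zV2 : z \in V :\: (Z :\ z) by rewrite inV2 zV eqxx orbT.
have [zX|zX] := boolP (z \in X).
  have cz p x : p \in V -> p \notin X :|: Z -> x \in X :|: Z -> c p x = c p z.
    move=> pV; rewrite !inE negb_or => /andP [pX pZ] /orP [] xX; last exact: hZ.
    by apply: hX; rewrite ?inV2 ?pV ?pZ.
  exists (X :|: Z); split.
  - by rewrite subUset ZV andbT (subset_trans XV) // subsetDl.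
  - by exists x0; rewrite inE x0X.
  - move: p0V; rewrite inV2 => /andP [p0V /orP [p0Z|/eqP p0z]]; last first.
      by rewrite p0z zX in p0X.
    by exists p0; rewrite // inE negb_or p0X.
  - by move=> p x y pV pX xX yX; rewrite !cz.
  move=> p x pV pX xX; rewrite (cz _ _ pV pX xX).
  move: pX; rewrite inE negb_or => /andP [pX pZ].
  by apply: colX; rewrite ?inV2 ?pV ?pZ.
have XZ x : x \in X -> x \in V /\ x \notin Z.
  move=> xX; have := subsetP XV _ xX; rewrite inV2 => /andP [-> /orP [//|/eqP xz]].
  by rewrite xz (negPf zX) in xX.
have rep p : p \in V -> p \notin X -> exists2 q, q \in V :\: (Z :\ z) /\ q \notin X
    & forall x, x \in X -> c p x = c q x.
  move=> pV pX; have [pZ|pZ] := boolP (p \in Z); last first.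
    by exists p; rewrite ?inV2 ?pV ?pZ.
  exists z => // x /XZ [xV xZ]; rewrite csym [RHS]csym; exact: hZ.
exists X; split.
- by apply/subsetP => x /XZ [].
- by exists x0.
- by exists p0 => //; move: p0V; rewrite inV2 => /andP [].
- move=> p x y pV pX xX yX; have [q [qV qX] E] := rep _ pV pX.
  by rewrite !E //; apply: hX.
move=> p x pV pX xX; have [q [qV qX] E] := rep _ pV pX.
by rewrite E //; apply: colX.
Qed.

(** Edges between [X] and the rest of [W] have color [a] or [b], so a component of another color
    stays on one side. *)
Lemma color_comp_proper W X a b d w : two_colored_module W X a b ->
  d <> a -> d <> b -> w \in W -> exists2 y, y \in W & y \notin color_comp W d w.
Proof.
move=> [XW [x0 x0X] [p0 p0W p0X] hX colX] da db wW.
have side u t : color_rel W d u t -> (u \in X) = (t \in X).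
  case/and4P=> uW tW ut /eqP cut.
  have [uX|uX] := boolP (u \in X); have [tX|tX] := boolP (t \in X) => //.
    by case: (colX t u tW tX uX); rewrite csym cut.
  by case: (colX u t uW uX tX); rewrite cut.
have sideC y : y \in color_comp W d w -> (y \in X) = (w \in X).
  by move: y; apply: color_comp_ind => // u t <- /side ->.
have [wX|wX] := boolP (w \in X).
  by exists p0 => //; apply/negP => /sideC; rewrite wX (negPf p0X).
by exists x0; rewrite ?(subsetP XW) //; apply/negP => /sideC; rewrite x0X (negPf wX).
Qed.

(* If no proper module is left, every color present at [v] is connected on [V];
   a color that disconnects [V :\ v] then meets all its components from [v], and
   this pins down every other color at [v]. *)
Lemma prime_vertex_two_colored V v d : v \in V ->
  color_comp V d v = V ->
  (forall w, w \in V :\ v -> exists2 y, y \in V :\ v & y \notin color_comp (V :\ v) d w) ->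
  forall z z', z \in V -> z != v -> z' \in V -> z' != v ->
    c v z != d -> c v z' != d -> c v z = c v z'.
Proof.
move=> vV Vd disc.
have V'P x : x \in V :\ v -> v != x /\ x \in V.
  by rewrite !inE eq_sym => /andP [].
(* On a path of color [d] from [v] to [z], the vertex after the last visit to [v] serves as [w]. *)
have root z : z \in V :\ v -> exists2 w, w \in V :\ v /\ c v w = d
    & z \in color_comp (V :\ v) d w.
  move=> zV'; have [vz zV] := V'P _ zV'.
  have : z \in color_comp V d v by rewrite Vd.
  move=> zc; rewrite eq_sym in vz; move: z zc vz {zV' zV}.
  apply: color_comp_ind; first by rewrite eqxx.
  move=> u w IH /and4P [uV wV uw /eqP cuw] wv.
  have wV' : w \in V :\ v by rewrite !inE wv.
  have [uv|uv] := eqVneq u v.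
    by exists w; [split=> //; rewrite -uv|rewrite inE connect0].
  have [t [tV ctv] ut] := IH uv; exists t => //.
  by apply: color_comp_trans ut _; apply: color_comp_edge; rewrite // !inE uv.
(* Different components give [c z t != d], so in the triangle [v z t] only [c z t = c v z]
   remains. *)
have cross w z t : z \in V :\ v -> z \in color_comp (V :\ v) d w ->
    t \in V :\ v -> c v t = d -> t \notin color_comp (V :\ v) d w ->
    c v z != d -> c t z = c v z.
  move=> zV' zw tV' cvt tw cz.
  have [vz zV] := V'P _ zV'; have [vt tV] := V'P _ tV'.
  have zt : z != t by apply: contraNneq tw => <-.
  have := gallai vz zt vt; rewrite cvt => -[E|->|E].
  - by rewrite E eqxx in cz.
  - by rewrite csym.
  case/negP: tw; apply: color_comp_trans zw _; exact: color_comp_edge.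
move=> z z' zV zv z'V z'v cz cz'.
have zV' : z \in V :\ v by rewrite !inE zv.
have z'V' : z' \in V :\ v by rewrite !inE z'v.
have [w [wV' cw] zw] := root z zV'; have [w' [w'V' cw'] z'w'] := root z' z'V'.
(* In a common component, a [d]-neighbour [t] of [v] from another component sees [z] and [z'] alike,
   by homogeneity. *)
have [z'w|z'w] := boolP (z' \in color_comp (V :\ v) d w).
  have [y yV' yw] := disc w wV'; have [t [tV' ct] yt] := root y yV'.
  have tw : t \notin color_comp (V :\ v) d w.
    by apply: contra yw => tw; apply: color_comp_trans yt.
  rewrite -(cross w z t) // -(cross w z' t) //.
  exact: color_comp_homogeneous wV' _ _ _ tV' tw zw z'w.
(* In different components, both colors equal that of the edge [w w']. *)
have w'w : w' \notin color_comp (V :\ v) d w.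
  by apply: contra z'w => w'w; apply: color_comp_trans z'w'.
have ww' : w \notin color_comp (V :\ v) d w' by rewrite color_comp_sym.
have self x : x \in color_comp (V :\ v) d x by rewrite inE connect0.
rewrite -(cross w z w') // -(cross w' z' w) //.
rewrite (color_comp_homogeneous wV' w'V' w'w zw (self w)) csym.
exact: color_comp_homogeneous w'V' _ _ _ wV' ww' (self w') z'w'.
Qed.

Theorem gallai_module V : 1 < #|V| -> exists X a b, two_colored_module V X a b.
Proof.
have [n] := ubnP #|V|; elim: n V => // n IH V; rewrite ltnS => Vn V1.
have [[Z [ZV hZ Z1 ZltV]]|prime] := EM (exists Z : {set T},
  [/\ Z \subset V, homogeneous V Z, 1 < #|Z| & #|Z| < #|V|]).
  have /card_gt0P [z zZ] : 0 < #|Z| by lia.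
  have E : #|V :\: (Z :\ z)| = #|V| - #|Z|.-1.
    rewrite cardsD (setIidPr _); last by rewrite (subset_trans _ ZV) ?subsetDl.
    by rewrite (cardsD1 z Z) zZ.
  have [||X [a [b H]]] := IH (V :\: (Z :\ z)); [lia|lia|].
  by have [X' ?] := contract_module ZV hZ zZ H; exists X', a, b.
have /card_gt0P [v vV] : 0 < #|V| by lia.
have V'1 : #|V| = #|V :\ v|.+1 by rewrite (cardsD1 v V) vV.
(* With no nontrivial module in [V], a single vertex serves: [v] has to be shown to see at most two
   colors. *)
exists [set v].
have [V'small|V'big] := leqP #|V :\ v| 1.
  have /card_gt0P [u uV] : 0 < #|V :\ v| by lia.
  exists (c v u), (c v u); apply: two_colored_module1 => // t tV tv; left.
  have tV' : t \in V :\ v by rewrite !inE tv.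
  by congr c; apply: (card_le1_eqP V'small).
have [|X [a [b H]]] := IH (V :\ v) _ V'big; first lia.
have [[u [uV uv ua ub]]|none] := EM (exists u, [/\ u \in V, u != v, c v u <> a & c v u <> b]);
  last first.
  exists a, b; apply: two_colored_module1 => // u uV uv.
  have [->|ua] := eqVneq (c v u) a; first by left.
  right; apply/eqP; apply: contraT => ub; case: none; exists u.
  by split=> //; apply/eqP.
(* As [d] differs from both colors leaving the module [X] of [V :\ v], it disconnects [V :\ v];
   primality makes it connected on [V]. *)
set d := c v u in ua ub.
have Vd : color_comp V d v = V.
  have sub := color_comp_sub d vV; apply/eqP; rewrite eqEcard sub /= leqNgt.
  apply/negP => lt; case: prime; exists (color_comp V d v); split=> //.
    exact: color_comp_homogeneous.
  apply/card_gt1P; exists u, v; split=> //; last by rewrite inE connect0.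
  by apply: color_comp_edge; rewrite // eq_sym.
have key := prime_vertex_two_colored vV Vd
  (fun w => @color_comp_proper _ _ _ _ _ w H ua ub).
exists d.
have [[z [zV zv zd]]|none] := EM (exists z, [/\ z \in V, z != v & c v z != d]); last first.
  exists d; apply: two_colored_module1 => // t tV tv; left.
  by apply/eqP; apply: contraT => td; case: none; exists t.
exists (c v z); apply: two_colored_module1 => // t tV tv.
by have [->|td] := eqVneq (c v t) d; [left|right; apply: key].
Qed.


(** * Orderable listings and the size recursion *)

Fixpoint ord (s : seq T) : Prop :=
  if s is x :: s' then (exists d, forall y, y \in s' -> c x y = d) /\ ord s'
  else True.

Definition obound (V : {set T}) k :=
  forall s, uniq s -> {subset s <= V} -> ord s -> size s <= k.

(** The vertex [v] can be put in front of every orderable listing of [W]. *)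
Lemma obound_apex (V W : {set T}) v d k : obound V k.+1 -> W \subset V -> v \in V ->
  v \notin W -> (forall w, w \in W -> c v w = d) -> obound W k.
Proof.
move=> oV WV vV vW cW s us sW os; rewrite -ltnS; apply: (oV (v :: s)) => /=.
- by rewrite us andbT; apply: contra vW => /sW.
- by move=> x; rewrite inE => /predU1P [-> //|/sW]; apply: (subsetP WV).
by split=> //; exists d => y /sW; apply: cW.
Qed.

(** The triangle [p x q] is not rainbow, so [c p q] is [c p x] or [c q x]. In the first case [p],
    then [q], can precede any listing of [X]; the second is symmetric. *)
Lemma obound_two_apexes (V X : {set T}) p q x k : obound V k.+2 -> X \subset V ->
  homogeneous V X -> p \in V -> p \notin X -> q \in V -> q \notin X -> x \in X ->
  c p x <> c q x -> obound X k.
Proof.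
wlog pq : p q / c p x = c p q => [wl|] oV XV hX pV pX qV qX xX neq.
  have px : p != x by apply: contraNneq pX => ->.
  have xq : x != q by apply: contraNneq qX => <-.
  have pq : p != q by apply/eqP => E; case: neq; rewrite E.
  have [|E|E] := gallai px xq pq.
  - by move=> E; apply: (wl p q).
  - by case: neq; rewrite E csym.
  by apply: (wl q p) => //; [rewrite csym -E csym|exact: nesym].
have oqX : obound (q |: X) k.+1.
  apply: (@obound_apex V _ p (c p x)) => //.
  - by rewrite subUset sub1set qV.
  - by rewrite !inE negb_or pX andbT; apply/eqP => E; case: neq; rewrite E.
  by move=> w /setU1P [-> //|wX]; apply: hX.
apply: (@obound_apex _ _ q (c q x) _ oqX) => //; first exact: subsetUr.
  by rewrite !inE eqxx.
by move=> w wX; apply: hX.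
Qed.

(** This is [F k <= n], restricted to vertex sets inside the fixed coloring [c]. *)
Definition ramsey_bound k n := forall V, obound V k -> #|V| <= n.

Lemma ramsey_bound1 : ramsey_bound 1 1.
Proof.
move=> V oV; rewrite leqNgt; apply/negP => /card_gt1P [x [y [xV yV xy]]].
suff: size [:: x; y] <= 1 by [].
apply: oV => /=; first by rewrite inE xy.
  by move=> z; rewrite !inE => /orP [] /eqP ->.
by split; [exists (c x y) => z /[!inE] /eqP ->|split=> //; exists (c x y)].
Qed.

(** In a triangle that is not rainbow some vertex sees the other two in one color; listed first, it
    makes the triangle orderable. *)
Lemma ramsey_bound2 : ramsey_bound 2 2.
Proof.
move=> V oV; rewrite leqNgt; apply/negP.
case/card_gt2P => x [y [z [[xV yV zV] [xy yz zx]]]].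
have key u v w : u \in V -> v \in V -> w \in V -> u != v -> v != w -> u != w ->
    c u v = c u w -> False.
  move=> uV vV wV uv vw uw E; suff: size [:: u; v; w] <= 2 by [].
  apply: oV => /=; first by rewrite !inE negb_or uv uw vw.
    by move=> t; rewrite !inE => /or3P [] /eqP ->.
  split; first by exists (c u v) => t /[!inE] /orP [] /eqP ->.
  by split; [exists (c v w) => t /[!inE] /eqP ->|split=> //; exists (c w w)].
have xz : x != z by rewrite eq_sym.
have := gallai xy yz xz => -[E|E|E].
- exact: (key x y z).
- by apply: (key y x z); rewrite // 1?eq_sym // csym.
by apply: (key z x y); rewrite // 1?eq_sym // csym E csym.
Qed.

Lemma monochromatic_cut_bound V X d k n : ramsey_bound k n -> obound V k.+1 ->
  X \subset V -> (exists x, x \in X) -> (exists2 p, p \in V & p \notin X) ->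
  (forall p x, p \in V -> p \notin X -> x \in X -> c p x = d) -> #|V| <= 2 * n.
Proof.
move=> kn oV XV [x xX] [p pV pX] cX.
have oX : obound X k by apply: (obound_apex oV XV pV pX) => w; apply: cX.
have oY : obound (V :\: X) k.
  apply: (@obound_apex _ _ x d _ oV); rewrite ?subsetDl ?(subsetP XV) ?inE ?xX //.
  by move=> w /setDP [wV wX]; rewrite csym; apply: cX.
have := kn _ oX; have := kn _ oY; have := cardsID X V.
by rewrite (setIidPr XV); lia.
Qed.

Definition side V X d :=
  [set p in V | (p \notin X) && [forall x in X, c p x == d]].

Lemma sideP V X d p x : x \in X -> p \in side V X d ->
  [/\ p \in V, p \notin X & c p x = d].
Proof.
move=> xX; rewrite inE => /and3P [pV pX /forallP /(_ x)].
by rewrite xX => /eqP.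
Qed.

Lemma two_colored_moduleC V X a b :
  two_colored_module V X a b -> two_colored_module V X b a.
Proof.
case=> ? ? ? ? H; split=> // p x pV pX xX.
by case: (H p x pV pX xX); [right|left].
Qed.

Lemma in_side V X a b p : two_colored_module V X a b ->
  p \in V -> p \notin X -> p \in side V X a \/ p \in side V X b.
Proof.
case=> XV [x xX] _ hX colX pV pX.
have [E|E] := colX p x pV pX xX; [left|right]; rewrite inE pV pX /=;
  by apply/forallP => y; apply/implyP => yX; rewrite -E; apply/eqP/hX.
Qed.

Lemma obound_side V X d k x : obound V k.+1 -> X \subset V -> x \in X ->
  obound (side V X d) k.
Proof.
move=> oV XV xX; apply: (@obound_apex _ _ x d _ oV).
- by apply/subsetP => p /(sideP xX) [].
- exact: (subsetP XV).
- by apply/negP => /(sideP xX) []; rewrite xX.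
by move=> w /(sideP xX) [_ _ <-].
Qed.

(** Above [2 * n] vertices the cut is not monochromatic, so both colors occur and differ; one
    outside vertex of each color then gives two apexes over [X]. *)
Lemma module_bound V X a b k n : ramsey_bound k.+1 n -> obound V k.+2 ->
  two_colored_module V X a b -> 2 * n < #|V| ->
  [/\ a <> b, obound X k & #|V| = #|X| + #|side V X a| + #|side V X b|].
Proof.
move=> kn oV mX Vn; have [XV [x xX] out hX colX] := mX.
have other d e : (forall p x, p \in V -> p \notin X -> x \in X -> c p x = d \/ c p x = e) ->
    exists2 p, p \in V /\ p \notin X & c p x = e /\ d <> e.
  move=> de; apply: contrapT => no.
  have : #|V| <= 2 * n; last by lia.
  apply: (@monochromatic_cut_bound V X d _ _ kn oV XV) => //; first by exists x.
  move=> p y pV pX yX; rewrite (hX p y x) //.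
  have [//|E] := de p x pV pX xX; apply: contrapT => ne; case: no; exists p => //.
  by split=> // de'; case: ne; rewrite E de'.
have [q [qV qX] [cq ab]] := other a b colX.
have [|p [pV pX] [cp _]] := other b a.
  by move=> p y pV pX yX; case: (colX p y pV pX yX); [right|left].
split=> //.
  by apply: (@obound_two_apexes V X p q x) => //; rewrite cp cq.
have VE : V = X :|: (side V X a :|: side V X b).
  apply/setP => t; rewrite !in_setU; apply/idP/idP.
    move=> tV; have [//|tX /=] := boolP (t \in X).
    by case: (in_side mX tV tX) => ->; rewrite ?orbT.
  by case/or3P => [/(subsetP XV)|/(sideP xX) []|/(sideP xX) []].
rewrite {1}VE !cardsU.
have -> : side V X a :&: side V X b = set0.
  apply/setP => t; rewrite in_setI in_set0; apply/negP => /andP [].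
  by case/(sideP xX) => _ _ ca /(sideP xX) [_ _ cb]; case: ab; rewrite -ca -cb.
have -> : X :&: (side V X a :|: side V X b) = set0.
  apply/setP => t; rewrite in_setI in_setU in_set0; apply/negP => /andP [tX].
  by case/orP => /(sideP xX) []; rewrite tX.
by rewrite !cards0; lia.
Qed.

(** * The bounds 5, 10 and 25 *)

Lemma ramsey_bound3 : ramsey_bound 3 5.
Proof.
move=> V oV; rewrite leqNgt; apply/negP => V5.
have [|X [a [b mX]]] := @gallai_module V; first lia.
have [XV [x xX] _ _ _] := mX.
have [|_ /ramsey_bound1 oX E] := module_bound ramsey_bound2 oV mX; first lia.
have := ramsey_bound2 (obound_side (d := a) oV XV xX).
have := ramsey_bound2 (obound_side (d := b) oV XV xX).
lia.
Qed.

(** If a proper [Z] is seen from outside in two colors, two apexes leave it one vertex; if in one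
    color, the monochromatic cut leaves [P] at most 4 vertices. *)
Lemma pentagon_prime (P Z : {set T}) : obound P 3 -> 4 < #|P| -> Z \subset P ->
  homogeneous P Z -> 1 < #|Z| -> Z = P.
Proof.
move=> oP P4 ZP hZ Z1; apply: contrapT => neq.
have /card_gt0P [z zZ] : 0 < #|Z| by lia.
have [q qP qZ] : exists2 q, q \in P & q \notin Z.
  apply/subsetPn; apply/negP => PZ; case: neq.
  by apply/eqP; rewrite eqEsubset ZP.
have [[p [pP pZ cp]]|no] :=
  EM (exists p, [/\ p \in P, p \notin Z & c p z <> c q z]).
  by have /ramsey_bound1 := obound_two_apexes oP ZP hZ pP pZ qP qZ zZ cp; lia.
have : #|P| <= 2 * 2; last by lia.
apply: (@monochromatic_cut_bound P Z (c q z) _ _ ramsey_bound2 oP ZP).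
- by exists z.
- by exists q.
move=> p x pP pZ xZ; rewrite (hZ p x z) //.
by apply: contrapT => ne; case: no; exists p.
Qed.

Lemma cross_sides V X a b p q x : a <> b -> x \in X ->
  p \in side V X a -> q \in side V X b -> c p q = a \/ c p q = b.
Proof.
move=> ab xX /(sideP xX) [_ pX cp] /(sideP xX) [_ qX cq].
have px : p != x by apply: contraNneq pX => ->.
have xq : x != q by apply: contraNneq qX => <-.
have pq : p != q by apply/eqP => E; case: ab; rewrite -cp -cq E.
have := gallai px xq pq; rewrite cp [c x q]csym cq.
by case=> [<-|//|->]; [left|right].
Qed.

(** All edges leaving the side have color [a] or [b], so a component of a third color stays inside
    it and, by [pentagon_prime], fills it. The side is then a two-colored module of [V], which two
    apexes limit to 2 vertices instead of 5. *)
Lemma side_colors V X a b p q : obound V 4 -> 10 < #|V| ->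
  two_colored_module V X a b -> #|side V X a| = 5 ->
  p \in side V X a -> q \in side V X a -> p != q -> c p q = a \/ c p q = b.
Proof.
move=> oV V10 mX P5 pP qP pq; have [XV [x xX] _ hX colX] := mX.
set P := side V X a in P5 pP qP *.
have [ab _ _] := module_bound ramsey_bound3 oV mX V10.
have PV : P \subset V by apply/subsetP => t /(sideP xX) [].
have out t u : t \in V -> t \notin P -> u \in P -> c t u = a \/ c t u = b.
  move=> tV tP uP; have [tX|tX] := boolP (t \in X).
    by have [_ _ E] := sideP tX uP; left; rewrite csym.
  have [tP'|tQ] := in_side mX tV tX; first by rewrite tP' in tP.
  by rewrite csym; apply: (cross_sides ab xX uP tQ).
apply: contrapT => /not_orP [pa pb].
have pV := subsetP PV _ pP; have qV := subsetP PV _ qP.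
pose Z := color_comp V (c p q) p.
have ZP : Z \subset P.
  apply/subsetP; apply: color_comp_ind => // u w uP.
  case/and4P => uV wV uw /eqP cuw; apply: contraT => wP.
  by case: (out w u wV wP uP); rewrite csym cuw.
have hZ : homogeneous V Z by apply: color_comp_homogeneous.
have ZE : Z = P.
  apply: pentagon_prime; rewrite ?P5 //; first exact: obound_side oV XV xX.
    by move=> t u w tP; apply: hZ; apply: (subsetP PV).
  apply/card_gt1P; exists p, q; split=> //; first by rewrite inE connect0.
  exact: color_comp_edge.
have mP : two_colored_module V P a b.
  split=> //; [by exists p| |by rewrite -ZE].
  exists x; first exact: (subsetP XV).
  by apply/negP => /(sideP xX) []; rewrite xX.
have [_ /ramsey_bound2] := module_bound ramsey_bound3 oV mP V10.
by rewrite P5.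
Qed.

(* A two-colored module leaves a 5-element color neighbourhood; its vertices see
   only two colors, which forces [V] to be a two-colored 5-regular graph on 11
   vertices. *)
Lemma ramsey_bound4 : ramsey_bound 4 10.
Proof.
move=> V oV; rewrite leqNgt; apply/negP => V10.
have [|X [a [b mX]]] := @gallai_module V; first lia.
(* Since [X] has at most 2 vertices and each side at most 5, a total above 10 leaves no room for two
   sides of size at most 4. *)
wlog P5 : a b mX / #|side V X a| = 5 => [wl|].
  have [XV [x xX] _ _ _] := mX.
  have [_ /ramsey_bound2 oX E] := module_bound ramsey_bound3 oV mX V10.
  have Pa := ramsey_bound3 (obound_side (d := a) oV XV xX).
  have Pb := ramsey_bound3 (obound_side (d := b) oV XV xX).
  have [E5|ne] := eqVneq #|side V X a| 5; first exact: (wl a b mX E5).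
  by apply: (wl b a); [apply: two_colored_moduleC|lia].
have [ab _ _] := module_bound ramsey_bound3 oV mX V10.
have [XV [x xX] _ _ _] := mX.
have /card_gt0P [p pP] : 0 < #|side V X a| by rewrite P5.
have [pV pX _] := sideP xX pP.
have V1 : 1 < #|V| by lia.
have mp : two_colored_module V [set p] a b.
  apply: two_colored_module1 => // u uV up.
  have [uX|uX] := boolP (u \in X); first by have [_ _ ->] := sideP uX pP; left.
  have [uP|uQ] := in_side mX uV uX; last exact: (cross_sides ab xX pP uQ).
  by apply: (side_colors oV V10 mX); rewrite // eq_sym.
(* For a one-vertex module the count is at most [1 + 5 + 5 = 11], so equality holds throughout. *)
have sizes t : t \in V -> two_colored_module V [set t] a b ->
    [/\ #|V| = 11, #|side V [set t] a| = 5 & #|side V [set t] b| = 5].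
  move=> tV mt; have [tsub _ _ _ _] := mt; have tt := set11 t.
  have [_ _] := module_bound ramsey_bound3 oV mt V10.
  have := ramsey_bound3 (obound_side (d := a) oV tsub tt).
  have := ramsey_bound3 (obound_side (d := b) oV tsub tt).
  by rewrite cards1 => *; split; lia.
have [V11 Pa Pb] := sizes p pV mp.
have two u w : u \in V -> w \in V -> u != w -> c u w = a \/ c u w = b.
  move=> uV wV uw; have pp := set11 p; have [_ _ _ _ colp] := mp.
  have [up|up] := eqVneq u p.
    by rewrite csym up; apply: colp; rewrite // inE -up eq_sym.
  have [wp|wp] := eqVneq w p.
    by rewrite wp; apply: colp; rewrite // inE.
  case: (in_side mp uV); rewrite ?in_set1 // => uS;
    case: (in_side mp wV); rewrite ?in_set1 // => wS.
  - exact: (side_colors oV V10 mp).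
  - exact: (cross_sides ab pp uS wS).
  - by rewrite csym; apply: (cross_sides ab pp wS uS).
  have := side_colors oV V10 (two_colored_moduleC mp) Pb uS wS uw.
  by case; [right|left].
(* Color [a] has degree 5 at each of the 11 vertices, and the degree sum 55 is odd. *)
have := @sum_degree_even _ V (fun u w => (u != w) && (c u w == a)).
rewrite (eq_bigr (fun _ => 5)) => [|t tV]; last first.
  have [||_ <- _] := sizes t => //.
    by apply: two_colored_module1 => // u uV ut; apply: two; rewrite // eq_sym.
  apply: eq_card => u; rewrite !inE eq_sym; congr (_ && (_ && _)).
  apply/eqP/forallP => [E w|/(_ t)]; last by rewrite in_set1 eqxx csym => /eqP.
  by apply/implyP => /set1P ->; rewrite csym E.
rewrite sum_nat_const V11 => /(_ _ _)/negP; apply=> //.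
  by move=> u w; rewrite eq_sym csym.
by move=> u; rewrite eqxx.
Qed.

Theorem ramsey_bound5 : ramsey_bound 5 25.
Proof.
move=> V oV; rewrite leqNgt; apply/negP => V25.
have [|X [a [b mX]]] := @gallai_module V; first lia.
have [XV [x xX] _ _ _] := mX.
have [|_ /ramsey_bound3 oX E] := module_bound ramsey_bound4 oV mX; first lia.
have := ramsey_bound4 (obound_side (d := a) oV XV xX).
have := ramsey_bound4 (obound_side (d := b) oV XV xX).
lia.
Qed.

End Gallai.

(** * From listings to copies of complete graphs *)

Lemma ord_nth (T : finType) (D : eqType) (c : T -> T -> D) x0 s i j k :
  ord c s -> i < j < size s -> i < k < size s ->
  c (nth x0 s i) (nth x0 s j) = c (nth x0 s i) (nth x0 s k).
Proof.
elim: s i j k => [|x s IH] [|i] [|j] [|k] //= [[d cd] os]; last exact: IH.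
by move=> js ks; rewrite !cd ?mem_nth.
Qed.

Lemma inherited2 (G H : sgraph) (C : Type) (chi : {set H} -> C) (f : G -> H) i j :
  inherited chi f [set i; j] = chi [set f i; f j].
Proof. by rewrite /inherited imsetU1 imset_set1. Qed.

Lemma nth_embedding n m (x0 : K n) (s : seq (K n)) : uniq s -> m <= size s ->
  embedding (fun i : K m => nth x0 s i).
Proof.
move=> us ms; have lts (i : K m) : i < size s by apply: leq_trans ms; apply: ltn_ord.
have inj : injective (fun i : K m => nth x0 s i).
  by move=> i j /eqP; rewrite nth_uniq ?lts // => /eqP /val_inj.
by split=> // i j; rewrite /= /K_adj; apply: contraNneq => /inj ->.
Qed.

Lemma edgesK3 (e : {set K 3}) : e \in edges (K 3) ->
  [\/ e = [set inord 0; inord 1], e = [set inord 0; inord 2]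
    | e = [set inord 1; inord 2]].
Proof.
rewrite inE => /existsP [i /existsP [j /andP [ij /eqP ->]]].
rewrite -(inord_val i) -(inord_val j).
move: ij; rewrite /= /K_adj -val_eqE /=.
case: i => [[|[|[|i]]] //= _]; case: j => [[|[|[|j]]] //= _] _.
all: try by constructor 1.
all: try by constructor 2.
all: try by constructor 3.
- by constructor 1; rewrite setUC.
- by constructor 2; rewrite setUC.
by constructor 3; rewrite setUC.
Qed.

Lemma rainbow_triangle n (C : Type) (chi : {set K n} -> C) (x y z : K n) :
  x != y -> y != z -> x != z ->
  chi [set x; y] <> chi [set x; z] -> chi [set x; y] <> chi [set y; z] ->
  chi [set x; z] <> chi [set y; z] -> has_rainbow_copy (K 3) chi.
Proof.
move=> xy yz xz n1 n2 n3; pose s : seq (K n) := [:: x; y; z].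
exists (fun i : K 3 => nth x s i); split.
  by apply: nth_embedding; rewrite //= !inE negb_or xy xz yz.
by move=> e e' /edgesK3 He /edgesK3 He'; case: He => ->; case: He' => -> //;
  rewrite !inherited2 !inordK //= => E;
  (case: (n1 E) || case: (n2 E) || case: (n3 E) ||
   case: (n1 (esym E)) || case: (n2 (esym E)) || case: (n3 (esym E))).
Qed.

(** The copy takes the first [m] entries of [s], ordered by position; [0 < m] makes [s] nonempty,
    and its head is the default of [nth]. *)
Lemma orderable_seq n m (C : Type) (chi : {set K n} -> C) (D : eqType)
    (c : K n -> K n -> D) (s : seq (K n)) :
  (forall x y z, c x y = c x z -> chi [set x; y] = chi [set x; z]) ->
  uniq s -> ord c s -> 0 < m -> m <= size s -> has_orderable_copy (K m) chi.
Proof.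
move=> cchi us os m0 ms; case: s us os ms => [|x0 s'] us os ms; first by rewrite leqNgt m0 in ms.
set s := x0 :: s' in us os ms; exists (fun i : K m => nth x0 s i).
split; first exact: nth_embedding.
exists (fun i j : K m => i <= j); split.
  split=> [i|i j /anti_leq /val_inj //|j i k|i j]; [exact: leqnn|exact: leq_trans|exact: leq_total].
move=> i j k ij ik lij lik; rewrite !inherited2; apply: cchi.
have lt (t : K m) : t < size s by apply: leq_trans ms; apply: ltn_ord.
apply: ord_nth => //; rewrite lt andbT ltn_neqAle.
  by rewrite lij andbT.
by rewrite lik andbT.
Qed.

Lemma canonical_ramsey_6_3_26 : canonical_ramsey 6 3 26.
Proof.
move=> C chi; apply: contrapT => /not_orP [no_ord no_rainbow].
(* The type [C] is arbitrary, so a color is encoded by its class of equally colored sets, which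
   lives in a finite type with decidable equality. *)
pose code (e : {set K 26}) := [set e' : {set K 26} | `[< chi e' = chi e >]].
have codeE e e' : code e = code e' <-> chi e = chi e'.
  split=> [E|E]; last by rewrite /code E.
  by have : e \in code e' by [rewrite -E inE; apply/asboolP]; rewrite inE => /asboolP.
pose c (x y : K 26) := code [set x; y].
have csym x y : c x y = c y x by rewrite /c setUC.
have gallai x y z : x != y -> y != z -> x != z ->
    [\/ c x y = c x z, c x y = c y z | c x z = c y z].
  move=> xy yz xz; apply: contrapT => nor.
  apply: no_rainbow; apply: (rainbow_triangle xy yz xz); rewrite -codeE => E;
    by apply: nor; do [by constructor 1|by constructor 2|by constructor 3].
have : #|[set: K 26]| <= 25.
  apply: (ramsey_bound5 csym gallai) => s us _ os; rewrite leqNgt; apply/negP => s6.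
  apply: no_ord; apply: (@orderable_seq _ _ _ _ _ c s) => // x y z.
  by move/codeE.
by rewrite cardsT card_ord.
Qed.

Lemma canonical_ramsey_mono s t m n : m <= n ->
  canonical_ramsey s t m -> canonical_ramsey s t n.
Proof.
move=> mn cm C chi; pose g : K m -> K n := widen_ord mn.
have ginj : injective g by move=> i j /(congr1 val) /= /val_inj.
have lift (G : sgraph) (f : G -> K m) : embedding f -> embedding (g \o f).
  move=> [finj fhom]; split; first exact: inj_comp.
  by move=> x y /fhom; apply: contraNneq => /ginj ->.
have inh (G : sgraph) (f : G -> K m) :
    inherited chi (g \o f) = inherited (fun e => chi (g @: e)) f.
  by apply: funext => e; rewrite /inherited imset_comp.
case: (cm C (fun e => chi (g @: e))) => -[f [ef cf]]; [left|right];
  by exists (g \o f); rewrite inh; split=> //; apply: lift.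
Qed.

(** * The coloring of [K 25] *)

Definition pentagon (a b : nat) := (a.+1 %% 5 == b) || (b.+1 %% 5 == a).

Lemma pentagonC a b : pentagon a b = pentagon b a.
Proof. exact: orbC. Qed.

(* The lexicographic product of two pentagons, with vertex [5 * i + j] standing
   for the pair [(i, j)]; the first component of a color tells inner edges from
   outer ones. *)
Definition pentagon2 (x y : nat) : bool * bool :=
  if x %/ 5 == y %/ 5 then (true, pentagon (x %% 5) (y %% 5))
  else (false, pentagon (x %/ 5) (y %/ 5)).

Lemma pentagon2_sym x y : pentagon2 x y = pentagon2 y x.
Proof.
by rewrite /pentagon2 eq_sym (pentagonC (x %% 5)) (pentagonC (x %/ 5)).
Qed.

(** Within one block, or across three, only two colors are available; if exactly two vertices share
    a block, the third sees them in the same color. *)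
Lemma pentagon2_gallai x y z :
  [\/ pentagon2 x y = pentagon2 x z, pentagon2 x y = pentagon2 y z
    | pentagon2 x z = pentagon2 y z].
Proof.
have pigeon (p q r : bool) (i : bool) :
    [\/ (i, p) = (i, q), (i, p) = (i, r) | (i, q) = (i, r)].
  by case: p q r => [] [] []; do ?[by constructor 1|by constructor 2|by constructor 3].
rewrite /pentagon2.
have [xy|xy] := eqVneq (x %/ 5) (y %/ 5).
  by rewrite -xy; case: eqP => // _; constructor 3.
have [xz|xz] := eqVneq (x %/ 5) (z %/ 5).
  rewrite -xz [y %/ 5 == _]eq_sym (negPf xy).
  by constructor 2; rewrite pentagonC.
have [yz|yz] := eqVneq (y %/ 5) (z %/ 5); last exact: pigeon.
by constructor 1; rewrite yz.
Qed.

(** Exhaustive search: after a first vertex [v] and its color [d], only the [d]-neighbours of [v]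
    can follow. Length 0 fails because the empty listing always exists. *)
Fixpoint ord_free k (S : seq nat) :=
  if k is k'.+1 then
    all (fun v => all (fun d => ord_free k' [seq u <- S | (u != v) && (pentagon2 v u == d)])
      [:: (true, true); (true, false); (false, true); (false, false)]) S
  else false.

Lemma ord_freeP n k S (s : seq 'I_n) : ord_free k S -> uniq s ->
  {subset map val s <= S} -> ord (fun x y : 'I_n => pentagon2 x y) s -> size s < k.
Proof.
elim: k S s => // k IH S [|v s] //= /allP free /andP [vs us] sS [[d cd] os].
have /and5P [f1 f2 f3 f4 _] := free v (sS v (mem_head _ _)).
have H : ord_free k [seq u : nat <- S | (u != v :> nat) && (pentagon2 v u == d)].
  by case: (d) => [] [] [].
rewrite ltnS; apply: (IH _ _ H) => //.
move=> u /mapP [w ws ->]; rewrite mem_filter cd // eqxx andbT sS ?andbT.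
  by apply: contraNneq vs => /val_inj <-.
by rewrite inE map_f ?orbT.
Qed.

Lemma ord_free_pentagon2 : ord_free 6 (iota 0 25).
Proof. by vm_compute. Qed.

(** Collecting the values over both orders of the endpoints avoids choosing one; on an edge,
    symmetry of [pentagon2] makes the set a singleton. *)
Definition pentagon2_chi (e : {set K 25}) : {set bool * bool} :=
  [set pentagon2 (x : 'I_25) (y : 'I_25) | x in e, y in e & x != y].

Lemma pentagon2_chiE (x y : K 25) : x != y ->
  pentagon2_chi [set x; y] = [set pentagon2 (x : 'I_25) (y : 'I_25)].
Proof.
move=> xy; apply/setP => d; rewrite inE; apply/imset2P/eqP => [[u w]|->].
  rewrite !inE => /orP [] /eqP -> /andP [/orP [] /eqP -> ne ->] //.
  - by rewrite eqxx in ne.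
  - by rewrite pentagon2_sym.
  by rewrite eqxx in ne.
by exists x y; rewrite ?inE ?eqxx ?xy ?orbT.
Qed.

Lemma pentagon2_not_orderable : ~ has_orderable_copy (K 6) pentagon2_chi.
Proof.
case=> f [[finj fhom] [r [[rr ra rt rtot] H]]].
(* Listed increasingly for [r], the six vertices map to an orderable listing, which the search
   excludes. *)
pose s := sort r (enum 'I_6).
have us : uniq s by rewrite sort_uniq enum_uniq.
have : size (map f s) < 6; last by rewrite size_map size_sort size_enum_ord.
apply: (ord_freeP ord_free_pentagon2); first by rewrite map_inj_uniq.
  by move=> u /mapP [w _ ->]; rewrite mem_iota ltn_ord.
have : sorted r s by apply: sort_sorted.
elim: s us => //= x s IH /andP [xs us] ps; split; last first.
  by apply: IH => //; apply: path_sorted ps.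
have rx := allP (order_path_min rt ps).
(* Nothing follows the last vertex, so any color serves there; elsewhere the color to the next
   vertex [y] is the witness. *)
case: s xs rx {IH us ps} => [|y s] xs rx; first by exists (true, true).
have neq z : z \in y :: s -> x != z by apply: contraTneq => <-.
exists (pentagon2 (f x : 'I_25) (f y : 'I_25)) => u /mapP [z zs ->].
have ys := mem_head y s.
have := H x z y (neq z zs) (neq y ys) (rx z zs) (rx y ys).
rewrite !inherited2 !pentagon2_chiE //; first exact: set1_inj.
  exact: fhom (neq y ys).
exact: fhom (neq z zs).
Qed.

Lemma pentagon2_not_rainbow : ~ has_rainbow_copy (K 3) pentagon2_chi.
Proof.
case=> f [[finj fhom] H].
have adjK i j : i < 3 -> j < 3 -> i != j -> @adj (K 3) (inord i) (inord j).
  by move=> i3 j3; rewrite /= /K_adj -val_eqE /= !inordK.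
have edge i j : i < 3 -> j < 3 -> i != j -> [set inord i; inord j] \in edges (K 3).
  move=> i3 j3 ij; rewrite inE; apply/existsP; exists (inord i).
  by apply/existsP; exists (inord j); rewrite adjK ?eqxx.
have chiE i j : i < 3 -> j < 3 -> i != j ->
    inherited pentagon2_chi f [set inord i; inord j] =
    [set pentagon2 (f (inord i) : 'I_25) (f (inord j) : 'I_25)].
  by move=> i3 j3 ij; rewrite inherited2 pentagon2_chiE //; exact: fhom (adjK _ _ i3 j3 ij).
have neq (i j k : nat) : k < 3 -> i < 3 -> j < 3 -> k != i -> k != j ->
    (inord k : 'I_3) \notin [set inord i; inord j].
  by move=> k3 i3 j3 ki kj; rewrite !inE -!val_eqE /= !inordK // negb_or ki.
(* Rainbowness turns two equal colors into two equal edges, but an endpoint of one is missing from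
   the other. *)
have [E|E|E] := pentagon2_gallai (f (inord 0) : 'I_25) (f (inord 1) : 'I_25)
  (f (inord 2) : 'I_25).
- have := H _ _ (edge 0 1 isT isT isT) (edge 0 2 isT isT isT).
  rewrite !chiE // E => /(_ erefl) F; have := @neq 0 2 1 isT isT isT isT isT.
  by rewrite -F !inE eqxx orbT.
- have := H _ _ (edge 0 1 isT isT isT) (edge 1 2 isT isT isT).
  rewrite !chiE // E => /(_ erefl) F; have := @neq 1 2 0 isT isT isT isT isT.
  by rewrite -F !inE eqxx.
have := H _ _ (edge 0 2 isT isT isT) (edge 1 2 isT isT isT).
rewrite !chiE // E => /(_ erefl) F; have := @neq 1 2 0 isT isT isT isT isT.
by rewrite -F !inE eqxx.
Qed.

Theorem mainTheorem1 :
  is_CR 6 3 26 /\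
  (forall (C : Type) (chi : {set K 26} -> C),
     has_orderable_copy (K 6) chi \/ has_rainbow_copy (K 3) chi) /\
  (exists (C : Type) (chi : {set K 25} -> C),
     ~ has_orderable_copy (K 6) chi /\ ~ has_rainbow_copy (K 3) chi).
Proof.
split; last split; [|exact: canonical_ramsey_6_3_26|]; last first.
  exists {set bool * bool}, pentagon2_chi.
  by split; [exact: pentagon2_not_orderable|exact: pentagon2_not_rainbow].
split; first exact: canonical_ramsey_6_3_26.
move=> m cm; rewrite leqNgt; apply/negP; rewrite ltnS => m25.
case: (canonical_ramsey_mono m25 cm pentagon2_chi).
  exact: pentagon2_not_orderable.
exact: pentagon2_not_rainbow.
Qed.
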